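(* Let $G$ be a stratified group (of any step) equipped with an arbitrary homogeneous distance $d$. If the projection norm of $d$ is not strictly convex, then there exists an infinite geodesic $\gamma\colon\mathbb{R}\to (G,d)$ which is not affine.
   Context: A stratified group is a connected, simply connected Lie group $G$ whose (finite-dimensional real) Lie algebra has a decomposition $\mathfrak{g}=V_1\oplus V_2\oplus\dots\oplus V_s$ with $V_s\neq\{0\}$ and $[V_1,V_k]=V_{k+1}$ for all $k=1,\dots,s$, where $V_{s+1}=\{0\}$; $s$ is its step. The dilation by $\lambda\in\mathbb{R}$ is $\delta_\lambda\colon G\to G$, $\delta_\lambda\exp(X_1+X_2+\dots+X_s)=\exp(\lambda X_1+\lambda^2X_2+\dots+\lambda^sX_s)$ for $X_k\in V_k$. A homogeneous distance on $G$ is a left-invariant distance $d$ (a metric) with $d(\delta_\lambda(g),\delta_\lambda(h))=\lambda d(g,h)$ for all $\lambda>0$ and $g,h\in G$. The projection norm of $d$ is $\|\cdot\|_d\colon V_1\to\mathbb{R}$, $\|X\|_d=d(e,\exp(X))$, where $e$ is the identity element (it is a norm). An infinite geodesic in $(G,d)$ is an isometric (i.e. distance-preserving) embedding $\gamma\colon\mathbb{R}\to(G,d)$: $d(\gamma(t),\gamma(s))=|t-s|$ for all $t,s$. A curve in $G$ is affine if it is a left translation of a one-parameter subgroup, $\gamma(t)=g\exp(tX)$ for some $g\in G$, $X\in\mathfrak{g}$. A norm is strictly convex if its unit sphere contains no non-degenerate line segment. *)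

(* Defs.v *)
From HB Require Import structures.
From mathcomp Require Import all_boot all_order all_algebra.
From mathcomp Require Import all_classical all_reals all_analysis.

Set Implicit Arguments.
Unset Strict Implicit.
Unset Printing Implicit Defensive.

Import Order.TTheory GRing.Theory Num.Theory.
Import numFieldNormedType.Exports.

Local Open Scope classical_set_scope.
Local Open Scope ring_scope.

(* A group with a topology; the compatibility of the two is part of
   [lie_group] below. *)
#[short(type="topGroupType")]
HB.structure Definition TopGroup := {G of Topological G & Group G}.

(* [Ck k f U], for U open: f is of class C^k on U. For k > 0 this asks that all
   directional derivatives exist and are of class C^(k-1); for k = 1, existence
   and continuity of the directional derivatives is the usual C^1 condition. *)
Fixpoint Ck (R : realType) (V W : normedModType R) (k : nat) (f : V -> W)
    (U : set V) : Prop :=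
  if k is k'.+1 then
    forall v : V,
      (forall x, U x -> derivable f x v) /\ Ck k' (fun x => 'D_v f x) U
  else {within U, continuous f}.

Definition smooth (R : realType) (V W : normedModType R) (f : V -> W)
    (U : set V) : Prop :=
  forall k, Ck k f U.

(* Homeomorphism [coords] from the open set [dom] of G onto the open set [cod]
   of R^n, with inverse [param]; both functions are total and their values
   outside [dom], resp. [cod], are irrelevant. *)
Record chart (R : realType) (n : nat) (G : topologicalType) := Chart {
  dom : set G;
  cod : set 'rV[R]_n;
  coords : G -> 'rV[R]_n;
  param : 'rV[R]_n -> G;
  dom_open : open dom;
  cod_open : open cod;
  coord_cod : forall g, dom g -> cod (coords g);
  param_dom : forall x, cod x -> dom (param x);
  coordK : forall g, dom g -> param (coords g) = g;
  paramK : forall x, cod x -> coords (param x) = x;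
  coord_continuous : {within dom, continuous coords};
  param_continuous : {within cod, continuous param}
}.

Record smooth_atlas (R : realType) (n : nat) (G : topologicalType)
    (A : set (chart R n G)) : Prop := SmoothAtlas {
  atlas_cover : forall g : G, exists2 c, A c & dom c g;
  atlas_transition : forall c c', A c -> A c' ->
    smooth (coords c' \o param c) (cod c `&` param c @^-1` dom c')
}.

Record lie_group (R : realType) (n : nat) (G : topGroupType)
    (A : set (chart R n G)) : Prop := LieGroup {
  lie_hausdorff : hausdorff_space G;
  lie_second_countable : @second_countable G;
  lie_atlas : smooth_atlas A;
  lie_mul_continuous : continuous (fun p : G * G => (p.1 * p.2)%g);
  lie_inv_continuous : continuous (fun g : G => (g^-1)%g);
  lie_mul_smooth : forall c1 c2 c3, A c1 -> A c2 -> A c3 ->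
    smooth (fun p : 'rV[R]_n * 'rV[R]_n =>
              coords c3 (param c1 p.1 * param c2 p.2)%g)
           [set p | [/\ cod c1 p.1, cod c2 p.2 &
                        dom c3 (param c1 p.1 * param c2 p.2)%g]];
  lie_inv_smooth : forall c1 c2, A c1 -> A c2 ->
    smooth (fun x : 'rV[R]_n => coords c2 ((param c1 x)^-1)%g)
           [set x | cod c1 x /\ dom c2 ((param c1 x)^-1)%g]
}.

(* Every loop is null-homotopic relative to its base point. *)
Definition simply_connected (R : realType) (G : topologicalType) : Prop :=
  forall p : R -> G, {within `[0, 1], continuous p} -> p 0 = p 1 ->
  exists H : R * R -> G,
    [/\ {within `[0, 1] `*` `[0, 1], continuous H},
        forall t, 0 <= t <= 1 -> H (0, t) = p t,
        forall t, 0 <= t <= 1 -> H (1, t) = p 0 &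
        forall s, 0 <= s <= 1 -> H (s, 0) = p 0 /\ H (s, 1) = p 0].

(* In all that follows, c is a chart around the identity, and its differential
   there identifies the Lie algebra of G, as the tangent space at the identity,
   with 'rV[R]_n. *)

(* Expression in the chart c, at the point of coordinates x, of the
   left-invariant vector field with value v at the identity: the differential
   of the left translation by [param c x] applied to v. *)
Definition left_field (R : realType) (n : nat) (G : topGroupType)
    (c : chart R n G) (v x : 'rV[R]_n) : 'rV[R]_n :=
  'D_v (fun y : 'rV[R]_n => coords c (param c x * param c y)%g)
       (coords c (1%g : G)).

(* Value at the identity of the commutator of the left-invariant vector fields
   X_v and X_w; in coordinates [X, Y] = DY.X - DX.Y, and X_v, X_w take the
   values v, w at the identity. *)
Definition lie_bracket (R : realType) (n : nat) (G : topGroupType)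
    (c : chart R n G) (v w : 'rV[R]_n) : 'rV[R]_n :=
  'D_v (left_field c w) (coords c (1%g : G))
  - 'D_w (left_field c v) (coords c (1%g : G)).

(* The exponential map: t |-> E (t v) is the one-parameter subgroup of G with
   velocity v at t = 0. *)
Definition exponential (R : realType) (n : nat) (G : topGroupType)
    (c : chart R n G) (E : 'rV[R]_n -> G) : Prop :=
  forall v : 'rV[R]_n,
    [/\ continuous (fun t : R => E (t *: v)),
        forall s t : R, E ((s + t) *: v) = (E (s *: v) * E (t *: v))%g &
        is_derive (0 : R) (1 : R) (fun t : R => coords c (E (t *: v))) v].

Definition is_span (R : realType) (n : nat) (S : set 'rV[R]_n)
    (U : {vspace 'rV[R]_n}) : Prop :=
  (forall x, S x -> x \in U) /\
  (forall W : {vspace 'rV[R]_n},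
     (forall x, S x -> x \in W) -> (U <= W)%VS).

(* The layers are V 1, ..., V s, together with V s.+1 = 0; the other values of
   V are irrelevant. *)
Record stratification (R : realType) (n : nat) (G : topGroupType)
    (c : chart R n G) (s : nat) (V : nat -> {vspace 'rV[R]_n}) : Prop :=
  Stratification {
  strat_step : (0 < s)%N;
  strat_full : (\sum_(k < s) V k.+1)%VS = fullv;
  strat_direct : directv (\sum_(k < s) V k.+1)%VS;
  strat_last : V s <> 0%VS;
  strat_end : V s.+1 = 0%VS;
  strat_bracket : forall k, (1 <= k <= s)%N ->
    is_span [set z | exists x y, [/\ x \in V 1%N, y \in V k &
                                    z = lie_bracket c x y]]
            (V k.+1)
}.

Definition dilations (R : realType) (n : nat) (G : Type)
    (s : nat) (V : nat -> {vspace 'rV[R]_n}) (E : 'rV[R]_n -> G)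
    (delta : R -> G -> G) : Prop :=
  forall (l : R) (X : 'I_s -> 'rV[R]_n), (forall k : 'I_s, X k \in V k.+1) ->
    delta l (E (\sum_(k < s) X k)) = E (\sum_(k < s) l ^+ k.+1 *: X k).

Record is_metric (R : realType) (G : Type) (d : G -> G -> R) : Prop := Metric {
  metric_ge0 : forall x y, 0 <= d x y;
  metric_eq0 : forall x y, d x y = 0 <-> x = y;
  metric_symm : forall x y, d x y = d y x;
  metric_tri : forall x y z, d x z <= d x y + d y z
}.

Record homogeneous_distance (R : realType) (G : groupType)
    (delta : R -> G -> G) (d : G -> G -> R) : Prop := HomogeneousDistance {
  homd_metric : is_metric d;
  homd_left_invariant : forall g x y, d (g * x)%g (g * y)%g = d x y;
  homd_dilation : forall (l : R) x y, 0 < l ->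
    d (delta l x) (delta l y) = l * d x y
}.

Definition projection_norm (R : realType) (n : nat) (G : groupType)
    (E : 'rV[R]_n -> G) (d : G -> G -> R) (X : 'rV[R]_n) : R :=
  d 1%g (E X).

(* Strict convexity of a norm N on the subspace U. *)
Definition strictly_convex (R : realType) (n : nat) (U : {vspace 'rV[R]_n})
    (N : 'rV[R]_n -> R) : Prop :=
  forall X Y, X \in U -> Y \in U -> X <> Y ->
    ~ (forall t : R, 0 <= t <= 1 -> N ((1 - t) *: X + t *: Y) = 1).

Definition infinite_geodesic (R : realType) (G : Type) (d : G -> G -> R)
    (gamma : R -> G) : Prop :=
  forall t s, d (gamma t) (gamma s) = `|t - s|.

Definition affine_curve (R : realType) (n : nat) (G : groupType)
    (E : 'rV[R]_n -> G) (gamma : R -> G) : Prop :=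
  exists (g : G) (X : 'rV[R]_n), forall t, gamma t = (g * E (t *: X))%g.

(* Main.v *)
Require Import Defs.
From HB Require Import structures.
From mathcomp Require Import all_boot all_order all_algebra.
From mathcomp Require Import all_classical all_reals all_analysis.
From mathcomp Require Import lra ring.

Set Implicit Arguments.
Unset Strict Implicit.
Unset Printing Implicit Defensive.

Import Order.TTheory GRing.Theory Num.Theory.
Import numFieldNormedType.Exports.

Local Open Scope classical_set_scope.
Local Open Scope ring_scope.

(** Let [X <> Y] in the first layer span a segment of the unit sphere of the
    projection norm. The curve that runs along [t |-> E (t *: X)] up to time 0
    and along [t |-> E (t *: Y)] afterwards turns at the origin, so it is not
    affine: either half of a one-parameter subgroup determines the whole, and
    with it the velocity at time 0.

    It is a geodesic. Each half is one by homogeneity. Across the corner, the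
    distance from time [a <= 0] to time [b > 0] is
    [d 1 (E (- a *: X) * E (b *: Y))], at most [b - a] by the triangle
    inequality. The vector [- a *: X + b *: Y] is [b - a] times a point of the
    segment, so its norm is exactly [b - a], and what remains is that the
    projection norm bounds the distance from below on such products:
      [d 1 (E (X + Y)) <= d 1 (E X * E Y)]   ([dist_exp_add_le]).
    By homogeneity the right-hand side is at least
    [d 1 ((E (X / k) * E (Y / k)) ^+ k)] for each [k], and the [k]-th powers
    tend to [E (X + Y)] by Trotter's product formula. The formula is only used
    at a small scale, where everything happens inside the chart around the
    identity, and homogeneity removes the scale afterwards.

    Passing to the limit requires the distance to be continuous for the manifold
    topology, which is not part of the definition of a homogeneous distance
    ([dist_continuous_at_id]). If [Z] lies in layer [k], then
    [d 1 (E (t *: Z))] is [|t| ^ (1 / k)] times a constant by homogeneity, hence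
    vanishes as [t] tends to 0. Decompose the basis vectors along the layers; the
    product [Phi t] of the corresponding factors [E (t_i *: X_ik)] then also has
    small distance to the identity for small [t]. In the chart, [Phi] is strictly
    differentiable at 0 with the identity as differential, so by the contraction
    principle its values on small vectors fill a neighbourhood of the identity.

    Both arguments need very little differential calculus: that the group law in
    the chart is strictly differentiable at the identity with differential
    [(v, w) |-> v + w] ([chart_mul_strict]). This follows from smoothness by the
    mean value inequality; strict differentiability of [t |-> E (t *: v)] and of
    products of such curves follows from it. *)

(** * The mean value inequality and strict differentiability *)

Lemma norm_row_le (R : realType) (n : nat) (x : 'rV[R]_n) (r : R) :
  0 <= r -> (forall j, `|x ord0 j| <= r) -> `|x| <= r.
Proof.
move=> r0 xr; rewrite [leLHS]/Num.Def.normr/= mx_normrE.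
by apply: bigmax_le => // -[i j] _ /=; rewrite ord1.
Qed.

Lemma norm_coord_le (R : realType) (n : nat) (x : 'rV[R]_n) j :
  `|x ord0 j| <= `|x|.
Proof.
rewrite [leRHS]/Num.Def.normr/= mx_normrE.
exact: (le_bigmax _ (fun ij : 'I_1 * 'I_n => `|x ij.1 ij.2|) (ord0, j)).
Qed.

Lemma sum_norm_coord_le (R : realType) (n : nat) (x : 'rV[R]_n) :
  \sum_j `|x ord0 j| <= n%:R * `|x|.
Proof.
rewrite (le_trans (ler_sum _ (fun j _ => norm_coord_le x j)))//.
by rewrite sumr_const card_ord mulr_natl.
Qed.

(** The scalar mean value theorem is applied to each coordinate; as the norm of
    a row is its largest coordinate, the intermediate point may depend on the
    coordinate. *)
Lemma mean_value_ge0 (R : realType) (V : normedModType R) (n : nat)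
    (f : V -> 'rV[R]_n) (p v : V) (h e : R) (a : 'rV[R]_n) : 0 <= h ->
  (forall t, 0 <= t <= h -> derivable f (p + t *: v) v) ->
  (forall t, 0 <= t <= h -> `|'D_v f (p + t *: v) - a| <= e) ->
  `|f (p + h *: v) - f p - h *: a| <= h * e.
Proof.
move=> h0 fd fe.
have e0 : 0 <= e by apply: le_trans (fe 0 _); rewrite ?lexx.
apply: norm_row_le; first exact: mulr_ge0.
move=> j; pose g t := f (p + t *: v) ord0 j.
have gd t : 0 <= t <= h -> is_derive t 1 g ('D_v f (p + t *: v) ord0 j).
  move=> th; have := fd _ th; have ft := fd _ th.
  move/derivable_mxP => /(_ ord0 j) fj.
  rewrite (derive_mx ft) mxE.
  have qE : (fun k : R => k^-1 *: ((g \o shift t) (k *: 1) - g t)) =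
     (fun k => k^-1 *: (((fun x => f x ord0 j) \o shift (p + t *: v)) (k *: v)
        - f (p + t *: v) ord0 j)).
    apply/funext => k /=; rewrite /g/= /shift/=; congr (_ *: (f _ _ _ - _)).
    by rewrite [_ *: 1]mulr1 scalerDl addrCA.
  by split; rewrite ?/derivable ?/derive qE.
have [c ch gE] : exists2 c, c \in `[0, h] &
    g h - g 0 = 'D_v f (p + c *: v) ord0 j * (h - 0).
  apply: MVT_segment => //.
    move=> t; rewrite in_itv/= => /andP[t0 th].
    by apply: gd; rewrite !ltW.
  apply: derivable_within_continuous => t; rewrite in_itv/= => th.
  exact: (@ex_derive _ _ _ _ _ _ _ (gd _ th)).
have -> : (f (p + h *: v) - f p - h *: a) ord0 j = g h - g 0 - h * a ord0 j.
  by rewrite /g scale0r addr0 !mxE.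
rewrite gE subr0 [X in X - _]mulrC -mulrBr normrM ger0_norm// ler_wpM2l//.
apply: le_trans (fe c _); last by move: ch; rewrite in_itv.
by apply: le_trans (norm_coord_le _ j); rewrite !mxE.
Qed.

Lemma mean_value (R : realType) (V : normedModType R) (n : nat)
    (f : V -> 'rV[R]_n) (p v : V) (h e : R) (a : 'rV[R]_n) :
  (forall t, `|t| <= `|h| -> derivable f (p + t *: v) v) ->
  (forall t, `|t| <= `|h| -> `|'D_v f (p + t *: v) - a| <= e) ->
  `|f (p + h *: v) - f p - h *: a| <= `|h| * e.
Proof.
have [h0 fd fe|h0 fd fe] := leP 0 h.
  rewrite ger0_norm//; apply: mean_value_ge0 => // t /andP[t0 th];
    by [apply: fd; rewrite !ger0_norm|apply: fe; rewrite !ger0_norm].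
have H t : 0 <= t <= - h -> `|h + t| <= `|h|.
  by move=> th; rewrite (ltr0_norm h0) ler_norml; lra.
have := @mean_value_ge0 R V n f (p + h *: v) v (- h) e a.
rewrite scaleNr addrK oppr_ge0 => /(_ (ltW h0)) /=.
have E t : p + h *: v + t *: v = p + (h + t) *: v.
  by rewrite -addrA scalerDl.
rewrite ltr0_norm// => K; apply: le_trans (K _ _).
- by rewrite -normrN scaleNr !opprD !opprK [- _ + _]addrC.
- by move=> t th; rewrite E; apply: fd; exact: H.
- by move=> t th; rewrite E; apply: fe; exact: H.
Qed.

(** Move along the directions [v i] one after the other: each step is controlled
    by [mean_value], and its intermediate points stay near [p0], where the
    derivative differs little from its value at [p0]. With the vectors of a basis
    for [v] this says that [f] is strictly differentiable at [p0]. *)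
Lemma C1_increment (R : realType) (V : normedModType R) (n : nat) (I : Type)
    (f : V -> 'rV[R]_n) (p0 : V) (v : I -> V) (r : seq I) :
  (forall i, \forall p \near p0, derivable f p (v i)) ->
  (forall i, {for p0, continuous ('D_(v i) f)}) ->
  forall e, 0 < e -> exists2 del, 0 < del & forall p (h : I -> R),
    `|p - p0| < del -> (forall i, `|h i| < del) ->
    `|f (p + \sum_(i <- r) h i *: v i) - f p
      - \sum_(i <- r) h i *: 'D_(v i) f p0| <= e * \sum_(i <- r) `|h i|.
Proof.
move=> fd fc e e0; elim: r => [|i r [d1 d10 IH]].
  exists 1 => // p h _ _; rewrite !big_nil addr0 subrr subr0 normr0 mulr0.
  exact: lexx.
have [d2 /= d20 fd2] : nbhs_ball_ (ball_ Num.norm) p0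
    (fun p => derivable f p (v i) /\ `|'D_(v i) f p - 'D_(v i) f p0| <= e).
  apply/nbhs_normP; near=> p; split; near: p; first exact: fd.
  have /cvgr_distC_le := fc i; exact.
(* The radius leaves room for one step along [v i]: the new base point is still
   within [d1] of [p0]. *)
pose M := 1 + `|v i|.
have M0 : 0 < M by rewrite ltr_pwDl.
have M1 : 1 <= M by rewrite lerDl.
pose d := Num.min (d1 / 2) (d2 / 2) / M.
have d0 : 0 < d by rewrite divr_gt0// lt_min !divr_gt0.
have dM : d * M = Num.min (d1 / 2) (d2 / 2) by rewrite divfK// gt_eqF.
have dMl : d <= d * M by rewrite ler_peMr// ltW.
have dd1 : d * M <= d1 / 2 by rewrite dM ge_min lexx.
have dd2 : d * M <= d2 / 2 by rewrite dM ge_min lexx orbT.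
exists d => // p h pd hd.
have tv t : `|t| <= `|h i| -> `|t *: v i| <= d * M.
  move=> th; rewrite normrZ ler_pM//; first exact: le_trans th (ltW (hd i)).
  by rewrite lerDr.
have near_p0 t : `|t| <= `|h i| -> `|p + t *: v i - p0| < d + d * M.
  move=> /tv tvd; rewrite addrAC (le_lt_trans (ler_normD _ _))//.
  exact: ltr_leD.
pose q := p + h i *: v i.
have step1 : `|f q - f p - h i *: 'D_(v i) f p0| <= `|h i| * e.
  have b2 t : `|t| <= `|h i| -> ball_ Num.norm p0 d2 (p + t *: v i).
    by move=> th /=; rewrite distrC; have := near_p0 _ th; lra.
  by apply: mean_value => t /b2 /fd2[].
have step2 := IH q h.
rewrite !big_cons.
have -> : p + (h i *: v i + \sum_(j <- r) h j *: v j) =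
    q + \sum_(j <- r) h j *: v j by rewrite addrA.
set A := f (q + _); set B := \sum_(j <- r) h j *: 'D_ _ f p0.
have -> : A - f p - (h i *: 'D_(v i) f p0 + B) =
   (f q - f p - h i *: 'D_(v i) f p0) + (A - f q - B).
  by rewrite [RHS]addrACA -opprD [X in _ = X - _]addrC subrKA.
rewrite (le_trans (ler_normD _ _))// mulrDr lerD//; first by rewrite mulrC.
apply: step2; first by have := near_p0 _ (lexx `|h i|); rewrite -/q; lra.
by move=> j; have := hd j; lra.
Unshelve. all: by end_near. Qed.

(** * The group law in the chart around the identity *)

Definition chart_mul (R : realType) (n : nat) (G : topGroupType)
    (c : chart R n G) (p : 'rV[R]_n * 'rV[R]_n) : 'rV[R]_n :=
  coords c (param c p.1 * param c p.2)%g.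

Definition mul_domain (R : realType) (n : nat) (G : topGroupType)
    (c : chart R n G) : set ('rV[R]_n * 'rV[R]_n) :=
  [set p | [/\ cod c p.1, cod c p.2 & dom c (param c p.1 * param c p.2)%g]].

Section LocalGroupLaw.
Context (R : realType) (n : nat) (G : topGroupType).
Context (A : set (chart R n G)) (c : chart R n G).
Hypotheses (G_lie : lie_group A) (Ac : A c) (c1 : dom c (1%g : G)).

Local Notation e0 := (coords c (1%g : G)).
Local Notation chart_mul := (chart_mul c).
Local Notation mul_domain := (mul_domain c).

Lemma param_continuous_at_id : {for e0, continuous (param c)}.
Proof.
have := @param_continuous _ _ _ c; rewrite continuous_open_subspace.
  by apply; rewrite inE; exact: coord_cod.
exact: cod_open.
Qed.

Lemma mul_domain_nbhs : nbhs (e0, e0) mul_domain.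
Proof.
have cod_nbhs : nbhs e0 (cod c).
  by apply: open_nbhs_nbhs; split; [exact: cod_open|exact: coord_cod].
have mulc : {for (e0, e0), continuous
    (fun p : 'rV[R]_n * 'rV[R]_n => (param c p.1 * param c p.2)%g)}.
  apply: (@continuous_comp _ _ _
    (fun p : 'rV[R]_n * 'rV[R]_n => (param c p.1, param c p.2))
    (fun p : G * G => (p.1 * p.2)%g)); last exact: (lie_mul_continuous G_lie).
  apply: (@cvg_pair _ _ _ _ (nbhs (param c e0)) (nbhs (param c e0))).
    apply: (@continuous_comp _ _ _ fst); first exact: cvg_fst.
    exact: param_continuous_at_id.
  apply: (@continuous_comp _ _ _ snd); first exact: cvg_snd.
  exact: param_continuous_at_id.
have dom_nbhs : nbhs (1%g : G) (dom c).
  by apply: open_nbhs_nbhs; split; [exact: dom_open|].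
have mulN : \forall p \near (e0, e0), dom c (param c p.1 * param c p.2)%g.
  by apply: mulc; rewrite /= !coordK// mulg1.
near=> p; split; last by near: p.
  by near: p; apply: (@cvg_fst _ _ (nbhs e0) (nbhs e0)).
by near: p; apply: (@cvg_snd _ _ (nbhs e0) (nbhs e0)).
Unshelve. all: by end_near. Qed.

Lemma chart_mul_derivel (v : 'rV[R]_n) : 'D_(v, 0) chart_mul (e0, e0) = v.
Proof.
have cod_nbhs : nbhs e0 (cod c).
  by apply: open_nbhs_nbhs; split; [exact: cod_open|exact: coord_cod].
apply: cvg_lim => //; apply: cvg_near_cst; near=> h.
rewrite /chart_mul /= scaler0 add0r coordK// mulg1 mulg1 !paramK//.
- by rewrite addrK scalerA mulVf ?scale1r//; near: h; exact: nbhs_dnbhs_neq.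
near: h; apply: nbhs_dnbhs.
have : {for (0 : R), continuous (fun h : R => h *: v + e0)}.
  apply: cvgD; last exact: cvg_cst.
  by apply: cvgZl; exact: cvg_id.
by apply; rewrite /= scale0r add0r.
Unshelve. all: by end_near. Qed.

Lemma chart_mul_deriver (v : 'rV[R]_n) : 'D_(0, v) chart_mul (e0, e0) = v.
Proof.
have cod_nbhs : nbhs e0 (cod c).
  by apply: open_nbhs_nbhs; split; [exact: cod_open|exact: coord_cod].
apply: cvg_lim => //; apply: cvg_near_cst; near=> h.
rewrite /chart_mul /= scaler0 add0r coordK// !mul1g !paramK//.
- by rewrite addrK scalerA mulVf ?scale1r//; near: h; exact: nbhs_dnbhs_neq.
near: h; apply: nbhs_dnbhs.
have : {for (0 : R), continuous (fun h : R => h *: v + e0)}.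
  apply: cvgD; last exact: cvg_cst.
  by apply: cvgZl; exact: cvg_id.
by apply; rewrite /= scale0r add0r.
Unshelve. all: by end_near. Qed.

Lemma chart_mul_derivable v : \forall p \near (e0, e0), derivable chart_mul p v.
Proof.
have [+ _] := lie_mul_smooth G_lie Ac Ac Ac 1%N v.
by move=> D; near=> p; apply: D; near: p; exact: mul_domain_nbhs.
Unshelve. all: by end_near. Qed.

Lemma chart_mul_C1 v : {for (e0, e0), continuous ('D_v chart_mul)}.
Proof.
have [_ +] := lie_mul_smooth G_lie Ac Ac Ac 1%N v => /=.
move=> /(_ (e0, e0)); rewrite /continuous_at /prop_for /=.
by rewrite -nbhs_subspace_interior//; exact: mul_domain_nbhs.
Qed.

(** Strict differentiability of the group law at the identity. The increment
    from [(x', y')] to [(x, y)] is split at [(x', y)]; on each part the partial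
    derivatives at the identity are known, since [x * 1 = x] and [1 * y = y]. *)
Lemma chart_mul_strict (e : R) : 0 < e -> exists2 del, 0 < del &
  forall x x' y y', `|x - e0| < del -> `|x' - e0| < del ->
    `|y - e0| < del -> `|y' - e0| < del ->
  [/\ mul_domain (x, y), mul_domain (x', y') &
  `|chart_mul (x, y) - chart_mul (x', y') - (x - x') - (y - y')|
    <= e * (`|x - x'| + `|y - y'|)].
Proof.
move=> e_gt0.
(* The increments in the [n] basis directions add up to at most [n] times the
   norm; [n.+1] avoids a division by zero. *)
pose eta := e / n.+1%:R.
have eta0 : 0 < eta by rewrite divr_gt0.
have etan : eta * n%:R <= e.
  by rewrite /eta mulrAC ler_pdivrMr// ler_wpM2l ?ler_nat// ltW.
pose bas j : 'rV[R]_n := delta_mx ord0 j.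
have sumE (x : 'rV[R]_n) : \sum_j x ord0 j *: bas j = x.
  by rewrite [RHS]row_sum_delta.
have [d0 /= d00 dom0] := (nbhs_normP _ _).1 mul_domain_nbhs.
have fst_sum (F : 'I_n -> 'rV[R]_n * 'rV[R]_n) :
    (\sum_j F j).1 = \sum_j (F j).1 by exact: big_morph.
have snd_sum (F : 'I_n -> 'rV[R]_n * 'rV[R]_n) :
    (\sum_j F j).2 = \sum_j (F j).2 by exact: big_morph.
have [d1 d10 Hl] : exists2 d1, 0 < d1 & forall p w, `|p - (e0, e0)| < d1 ->
    `|w| < d1 -> `|chart_mul (p + (w, 0)) - chart_mul p - w| <= e * `|w|.
  have [d1 d10 H] := C1_increment (v := fun j => (bas j, 0)) (index_enum 'I_n)
    (fun j => chart_mul_derivable (bas j, 0))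
    (fun j => @chart_mul_C1 (bas j, 0)) eta0.
  exists d1 => // p w pd wd.
  have := H p (w ord0) pd (fun j => le_lt_trans (norm_coord_le w j) wd).
  have -> : \sum_j w ord0 j *: (bas j, (0 : 'rV[R]_n)) = (w, 0).
    apply: injective_projections; rewrite /= ?fst_sum ?snd_sum /= ?sumE//.
    by rewrite big1// => j _; rewrite scaler0.
  rewrite (eq_bigr (fun j => w ord0 j *: bas j)); last first.
    by move=> j _; rewrite chart_mul_derivel.
  rewrite sumE => /le_trans; apply.
  apply: le_trans (ler_wpM2l (ltW eta0) (sum_norm_coord_le w)) _.
  by rewrite mulrA ler_wpM2r.
have [d2 d20 Hr] : exists2 d2, 0 < d2 & forall p w, `|p - (e0, e0)| < d2 ->
    `|w| < d2 -> `|chart_mul (p + (0, w)) - chart_mul p - w| <= e * `|w|.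
  have [d2 d20 H] := C1_increment (v := fun j => (0, bas j)) (index_enum 'I_n)
    (fun j => chart_mul_derivable (0, bas j))
    (fun j => @chart_mul_C1 (0, bas j)) eta0.
  exists d2 => // p w pd wd.
  have := H p (w ord0) pd (fun j => le_lt_trans (norm_coord_le w j) wd).
  have -> : \sum_j w ord0 j *: ((0 : 'rV[R]_n), bas j) = (0, w).
    apply: injective_projections; rewrite /= ?fst_sum ?snd_sum /= ?sumE//.
    by rewrite big1// => j _; rewrite scaler0.
  rewrite (eq_bigr (fun j => w ord0 j *: bas j)); last first.
    by move=> j _; rewrite chart_mul_deriver.
  rewrite sumE => /le_trans; apply.
  apply: le_trans (ler_wpM2l (ltW eta0) (sum_norm_coord_le w)) _.
  by rewrite mulrA ler_wpM2r.
pose d := Num.min d0 (Num.min (d1 / 2) (d2 / 2)).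
have dP : [/\ 0 < d, d <= d0, d <= d1 / 2 & d <= d2 / 2].
  by rewrite !lt_min d00 !divr_gt0// !ge_min !lexx !orbT.
move: dP => [d_gt0 dd0 dd1 dd2].
exists d => // x x' y y' xd xd' yd yd'.
have pair_near (a b : 'rV[R]_n) r : `|a - e0| < r -> `|b - e0| < r ->
    `|(a, b) - (e0, e0)| < r.
  by move=> ar br; rewrite prod_normE /= gt_max ar br.
have dist_lt (a b : 'rV[R]_n) r : `|a - e0| < r -> `|b - e0| < r ->
    `|b - a| < 2 * r.
  move=> ar br; rewrite -(subrKA e0) (le_lt_trans (ler_normD _ _))//.
  by rewrite [`|e0 - a|]distrC; lra.
split.
- apply: dom0 => /=; rewrite distrC; apply: lt_le_trans dd0; exact: pair_near.
- apply: dom0 => /=; rewrite distrC; apply: lt_le_trans dd0; exact: pair_near.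
have Hx : `|chart_mul (x, y) - chart_mul (x', y) - (x - x')|
    <= e * `|x - x'|.
  have {1}-> : (x, y) = (x', y) + (x - x', 0).
    by apply: injective_projections; rewrite /= ?addr0// addrC subrK.
  apply: Hl.
    by apply: lt_le_trans (pair_near _ _ _ xd' yd) _; lra.
  by apply: lt_le_trans (dist_lt _ _ _ xd' xd) _; lra.
have Hy : `|chart_mul (x', y) - chart_mul (x', y') - (y - y')|
    <= e * `|y - y'|.
  have {1}-> : (x', y) = (x', y') + (0, y - y').
    by apply: injective_projections; rewrite /= ?addr0// addrC subrK.
  apply: Hr.
    by apply: lt_le_trans (pair_near _ _ _ xd' yd') _; lra.
  by apply: lt_le_trans (dist_lt _ _ _ yd' yd) _; lra.
rewrite mulrDr; apply: le_trans (lerD Hx Hy).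
apply: le_trans (ler_normD _ _).
rewrite le_eqVlt; apply/orP; left; apply/eqP; congr `|_|.
by rewrite [RHS]addrACA subrKA -opprD -addrA -opprD.
Qed.

End LocalGroupLaw.

(** Matrices carry both a norm and a complete uniform structure; this joins the
    two, as the fixed point theorem requires. *)
HB.instance Definition _ (R : realType) (m n : nat) := Complete.on 'M[R]_(m, n).

(** * Maps into the group that are strictly differentiable at the identity *)

(** Strict differentiability, at 0 and in the chart, of a map sending 0 to the
    identity. The bound on [L] stands for the continuity of the differential,
    and makes [phi] Lipschitz near 0 in the chart. *)
Definition strict_at_id (R : realType) (n : nat) (G : topGroupType)
    (c : chart R n G) (T : normedModType R) (phi : T -> G)
    (L : T -> 'rV[R]_n) : Prop :=
  [/\ phi 0 = 1%g, exists2 K, 0 <= K & forall t, `|L t| <= K * `|t| &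
    forall e, 0 < e -> exists2 del, 0 < del & forall t t',
      `|t| < del -> `|t'| < del -> [/\ dom c (phi t), dom c (phi t') &
        `|coords c (phi t) - coords c (phi t') - L (t - t')| <= e * `|t - t'|]].

Section StrictDifferentiability.
Context (R : realType) (n : nat) (G : topGroupType).
Context (A : set (chart R n G)) (c : chart R n G).
Hypotheses (G_lie : lie_group A) (Ac : A c) (c1 : dom c (1%g : G)).

Local Notation e0 := (coords c (1%g : G)).

Lemma group_mul_strict (e : R) : 0 < e -> exists2 del, 0 < del &
  forall g g' h h', dom c g -> dom c g' -> dom c h -> dom c h' ->
    `|coords c g - e0| < del -> `|coords c g' - e0| < del ->
    `|coords c h - e0| < del -> `|coords c h' - e0| < del ->
  [/\ dom c (g * h)%g, dom c (g' * h')%g &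
  `|coords c (g * h)%g - coords c (g' * h')%g
     - (coords c g - coords c g') - (coords c h - coords c h')|
    <= e * (`|coords c g - coords c g'| + `|coords c h - coords c h'|)].
Proof.
move=> /(chart_mul_strict G_lie Ac c1)[d d0 H]; exists d => // g g' h h'.
move=> cg cg' ch ch' gd gd' hd hd'.
have [[_ _ +] [_ _ +]] := H _ _ _ _ gd gd' hd hd'.
by rewrite /chart_mul /= !coordK.
Qed.

Lemma strict_one (T : normedModType R) :
  strict_at_id c (fun=> 1%g) (fun _ : T => 0).
Proof.
split=> //; first by exists 0 => // t; rewrite normr0 mul0r.
move=> e e_gt0; exists 1 => // t t' _ _; split => //.
by rewrite !subrr normr0 mulr_ge0// ltW.
Qed.

Lemma strict_comp (S T : normedModType R) (phi : S -> G) (L : S -> 'rV[R]_n)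
    (l : T -> S) :
  l 0 = 0 -> (forall t t', l (t - t') = l t - l t') ->
  (forall t, `|l t| <= `|t|) ->
  strict_at_id c phi L -> strict_at_id c (phi \o l) (L \o l).
Proof.
move=> l0 lB l1 [phi1 [K K0 LK] H]; split; first by rewrite /= l0.
  by exists K => // t; apply: le_trans (LK _) _; rewrite ler_wpM2l.
move=> e e_gt0; have [d d0 {}H] := H e e_gt0; exists d => // t t' td td'.
have [? ? h] := H (l t) (l t') (le_lt_trans (l1 _) td) (le_lt_trans (l1 _) td').
split => //=; rewrite lB; apply: le_trans h _.
by rewrite ler_wpM2l ?(ltW e_gt0)// -lB.
Qed.

(** The differential of a product is the sum of the differentials, because that
    of the group law at the identity is [(v, w) |-> v + w]. *)
Lemma strict_mul (T : normedModType R) (phi psi : T -> G)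
    (L M : T -> 'rV[R]_n) :
  strict_at_id c phi L -> strict_at_id c psi M ->
  strict_at_id c (fun t => phi t * psi t)%g (fun t => L t + M t).
Proof.
move=> [phi1 [K K0 LK] Hphi] [psi1 [K' K'0 MK] Hpsi]; split.
- by rewrite phi1 psi1 mulg1.
- exists (K + K'); first exact: addr_ge0.
  by move=> t; rewrite mulrDl (le_trans (ler_normD _ _))// lerD.
move=> e e_gt0.
pose e1 := e / 3 / (K + K' + 2).
have K2 : 0 < K + K' + 2 by lra.
have e10 : 0 < e1 by rewrite !divr_gt0.
have e1E : e1 * (K + K' + 2) = e / 3 by rewrite /e1 divfK// gt_eqF.
have [d1 d10 Hm] := group_mul_strict e10.
pose e2 := Num.min 1 (e / 3).
have e20 : 0 < e2 by rewrite lt_min ltr01 divr_gt0.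
have e21 : e2 <= 1 by rewrite ge_min lexx.
have e2e : e2 <= e / 3 by rewrite ge_min lexx orbT.
have [d2 d20 {}Hphi] := Hphi e2 e20.
have [d3 d30 {}Hpsi] := Hpsi e2 e20.
pose d := Num.min (d1 / (K + K' + 2)) (Num.min d2 d3).
have [d0 dd1 dd2 dd3] :
    [/\ 0 < d, d <= d1 / (K + K' + 2), d <= d2 & d <= d3].
  by rewrite !lt_min d20 d30 divr_gt0// !ge_min !lexx !orbT.
exists d => // t t' td td'.
have [cp cp' Hp] := Hphi t t' (lt_le_trans td dd2) (lt_le_trans td' dd2).
have [cq cq' Hq] := Hpsi t t' (lt_le_trans td dd3) (lt_le_trans td' dd3).
have lip (f : T -> G) (N : T -> 'rV[R]_n) k (s s' : T) :
    (forall u, `|N u| <= k * `|u|) ->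
    `|coords c (f s) - coords c (f s') - N (s - s')| <= e2 * `|s - s'| ->
    `|coords c (f s) - coords c (f s')| <= (k + 1) * `|s - s'|.
  move=> Nk fs; rewrite -[X in `|X|](subrK (N (s - s'))).
  rewrite (le_trans (ler_normD _ _))// mulrDl addrC lerD//.
  by apply: le_trans fs _; rewrite ler_wpM2r.
have small k (s : T) : 0 <= k -> k <= K + K' -> `|s| < d -> (k + 1) * `|s| < d1.
  move=> k0 kK sd; have : `|s| * (K + K' + 2) < d1.
    by rewrite -ltr_pdivlMr//; exact: lt_le_trans dd1.
  apply: le_lt_trans; rewrite mulrC ler_wpM2l//; lra.
have Kle : K <= K + K' by rewrite lerDl.
have K'le : K' <= K + K' by rewrite lerDr.
have nphi s : `|s| < d -> `|coords c (phi s) - e0| < d1.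
  move=> sd; apply: le_lt_trans (small K s K0 Kle sd).
  have d20' : `|0 : T| < d2 by rewrite normr0.
  have [_ _] := Hphi s 0 (lt_le_trans sd dd2) d20'.
  by move=> /(lip _ _ _ _ _ LK); rewrite phi1 subr0.
have npsi s : `|s| < d -> `|coords c (psi s) - e0| < d1.
  move=> sd; apply: le_lt_trans (small K' s K'0 K'le sd).
  have d30' : `|0 : T| < d3 by rewrite normr0.
  have [_ _] := Hpsi s 0 (lt_le_trans sd dd3) d30'.
  by move=> /(lip _ _ _ _ _ MK); rewrite psi1 subr0.
have [cm cm' Hmm] := Hm _ _ _ _ cp cp' cq cq'
  (nphi _ td) (nphi _ td') (npsi _ td) (npsi _ td').
split=> //.
set m := coords c _ in Hmm *; set m' := coords c _ in Hmm *.
set a := coords c (phi t) - _ in Hp Hmm *.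
set b := coords c (psi t) - _ in Hq Hmm *.
set u := `|t - t'| in Hp Hq *.
have -> : m - m' - (L (t - t') + M (t - t')) =
    (m - m' - a - b) + ((a - L (t - t')) + (b - M (t - t'))).
  by apply/rowP => j; rewrite !mxE; ring.
have u0 : 0 <= u by exact: normr_ge0.
have ab : `|a| + `|b| <= (K + K' + 2) * u.
  have := lip _ _ _ _ _ LK Hp; have := lip _ _ _ _ _ MK Hq.
  by rewrite -/a -/b -/u; nra.
have : e1 * (`|a| + `|b|) <= e / 3 * u.
  by rewrite -e1E -mulrA ler_wpM2l// ltW.
have : e2 * u <= e / 3 * u by rewrite ler_wpM2r.
have := ler_normD (m - m' - a - b) ((a - L (t - t')) + (b - M (t - t'))).
have := ler_normD (a - L (t - t')) (b - M (t - t')).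
lra.
Qed.

Lemma strict_prod (T : normedModType R) (I : Type) (r : seq I)
    (phi : I -> T -> G) (L : I -> T -> 'rV[R]_n) :
  (forall i, strict_at_id c (phi i) (L i)) ->
  strict_at_id c (fun t => \big[*%g/1%g]_(i <- r) phi i t)
    (fun t => \sum_(i <- r) L i t).
Proof.
move=> H; elim: r => [|i r IH].
  under [X in strict_at_id _ X]eq_fun do rewrite big_nil.
  under [X in strict_at_id _ _ X]eq_fun do rewrite big_nil.
  exact: strict_one.
under [X in strict_at_id _ X]eq_fun do rewrite big_cons.
under [X in strict_at_id _ _ X]eq_fun do rewrite big_cons.
exact: strict_mul.
Qed.

(** Differentiability of the one-parameter subgroup at the single time 0
    becomes strict: [E (t *: v)] is the product of [E (t' *: v)] and
    [E ((t - t') *: v)], and near the identity multiplying on the left by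
    [E (t' *: v)] moves the second factor away from 1 as if it were an
    addition. *)
Lemma strict_exp (E : 'rV[R]_n -> G) (v : 'rV[R]_n) : exponential c E ->
  strict_at_id c (fun t : R => E (t *: v)) (fun t => t *: v).
Proof.
move=> /(_ v)[Ec EM dE].
have E0 : E 0 = 1%g.
  have := EM 0 0; rewrite addr0 scale0r => /(congr1 (fun x => (E 0)^-1 * x))%g.
  by rewrite mulVg mulKg.
split; first by rewrite scale0r.
  by exists `|v| => // t; rewrite normrZ mulrC.
move=> e e_gt0.
pose x (t : R) := coords c (E (t *: v)).
have x0 : x 0 = e0 by rewrite /x scale0r E0.
pose eta := Num.min 1 (e / 2).
have eta0 : 0 < eta by rewrite lt_min ltr01 divr_gt0.
have [d1 d10 Hd] : exists2 d1, 0 < d1 & forall t, `|t| < d1 ->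
    dom c (E (t *: v)) /\ `|x t - e0 - t *: v| <= eta * `|t|.
  have domN : \forall t \near (0 : R), dom c (E (t *: v)).
    have := Ec 0; apply; rewrite /= scale0r E0.
    by apply: open_nbhs_nbhs; split; [exact: dom_open|].
  have derN : \forall t \near (0 : R), `|x t - e0 - t *: v| <= eta * `|t|.
    have [dx Dx] := dE.
    have : (fun h => h^-1 *: ((x \o shift 0) (h *: 1) - x 0)) @ (0 : R)^' --> v.
      by rewrite -Dx; exact: dx.
    move=> /cvgr_distC_le/(_ _ eta0) H.
    have {}H : \forall t \near (0 : R), t != 0 ->
      `|t^-1 *: ((x \o shift 0) (t *: 1) - x 0) - v| <= eta by [].
    apply: filterS H => t; have [->|t0] := eqVneq t 0.
      by move=> _; rewrite x0 scale0r subr0 subrr !normr0 mulr0.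
    move=> /(_ isT); rewrite /= addr0 [t *: 1]mulr1 x0 => H.
    have -> : x t - e0 - t *: v = t *: (t^-1 *: (x t - e0) - v).
      by rewrite scalerBr scalerA divff// scale1r.
    by rewrite normrZ mulrC ler_wpM2r.
  have [d1 /= d10 H] := nbhs_norm0P.1 (filterI domN derN).
  by exists d1 => // t td; exact: H.
pose K := `|v| + 1.
have K0 : 0 < K by rewrite ltr_wpDl.
have xlip t : `|t| < d1 -> `|x t - e0| <= K * `|t|.
  move=> /Hd[_ xt]; rewrite -[X in `|X|](subrK (t *: v)).
  rewrite (le_trans (ler_normD _ _))// mulrC mulrDr addrC lerD ?normrZ//.
  by apply: le_trans xt _; rewrite [leRHS]mulrC ler_wpM2r// ge_min lexx.
pose e1 := e / 2 / K.
have e10 : 0 < e1 by rewrite !divr_gt0.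
have [d2 d20 Hm] := group_mul_strict e10.
pose d := Num.min d1 (d2 / K) / 2.
have [d0 dd1 dd2] : [/\ 0 < d, 2 * d <= d1 & 2 * d <= d2 / K].
  have -> : 2 * d = Num.min d1 (d2 / K) by rewrite /d mulrC divfK.
  by rewrite divr_gt0 ?lt_min ?d10 ?divr_gt0// !ge_min !lexx !orbT.
exists d => // t t' td td'.
have tsd : `|t - t'| < 2 * d.
  by apply: le_lt_trans (ler_normB _ _) _; lra.
have near_x s : `|s| < 2 * d -> `|x s - e0| < d2.
  move=> sd; apply: le_lt_trans (xlip _ (lt_le_trans sd dd1)) _.
  by rewrite mulrC -ltr_pdivlMr//; exact: lt_le_trans dd2.
have td2 : `|t'| < 2 * d by lra.
have [ct _] : dom c (E (t *: v)) /\ `|x t - e0 - t *: v| <= eta * `|t|.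
  by apply: Hd; lra.
have [ct' _] := Hd t' (lt_le_trans td2 dd1).
have [cs xs] := Hd _ (lt_le_trans tsd dd1).
(* Compare the products of [E (t' *: v)] with [E ((t - t') *: v)] and with 1. *)
have := Hm _ _ _ _ ct' ct' cs c1 (near_x _ td2) (near_x _ td2) (near_x _ tsd).
rewrite !subrr normr0 => /(_ d20)[_ _].
rewrite mulg1 -EM [t' + _]addrC subrK subr0 add0r -/(x t) -/(x t') -/(x (t - t')).
move=> H; split => //.
have -> : x t - x t' - (t - t') *: v = (x t - x t' - (x (t - t') - e0)) +
   (x (t - t') - e0 - (t - t') *: v) by rewrite subrKA.
rewrite (le_trans (ler_normD _ _))// [e]splitr mulrDl lerD//.
  apply: le_trans H _.
  have := xlip _ (lt_le_trans tsd dd1).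
  have -> : e / 2 = e1 * K by rewrite /e1 divfK// gt_eqF.
  by rewrite -mulrA ler_pM2l.
by apply: le_trans xs _; rewrite ler_wpM2r// ge_min lexx orbT.
Qed.

(** The surjective half of the inverse function theorem: a preimage of [g] is a
    fixed point of [t |-> t - (phi t - g)], computed in the chart, which strict
    differentiability makes a contraction of a small closed ball. *)
Lemma strict_locally_onto (phi : 'rV[R]_n -> G) :
  strict_at_id c phi id -> forall del, 0 < del -> exists2 rho, 0 < rho &
  forall g, dom c g -> `|coords c g - e0| < rho ->
    exists2 t, `|t| < del & phi t = g.
Proof.
move=> [phi1 _ /(_ (1 / 2))[|d1 d10 H]]; first by rewrite divr_gt0.
move=> del del0; pose r := Num.min del d1 / 2.
have r0 : 0 < r by rewrite divr_gt0// lt_min del0.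
have rr : 2 * r = Num.min del d1 by rewrite /r mulrC divfK.
have r_del : 2 * r <= del by rewrite rr ge_min lexx.
have r_d1 : 2 * r <= d1 by rewrite rr ge_min lexx orbT.
exists (r / 2); first by rewrite divr_gt0.
move=> g cg gr.
pose U := closed_ball_ Num.norm (0 : 'rV[R]_n) r.
have UE t : U t <-> `|t| <= r by rewrite /U/closed_ball_/= sub0r normrN.
pose f t := t - (coords c (phi t) - coords c g).
have fB t t' : `|t| <= r -> `|t'| <= r -> `|f t - f t'| <= 1 / 2 * `|t - t'|.
  move=> tr tr'; have [||_ _] := H t t'; [lra|lra|].
  apply: le_trans; rewrite -normrN le_eqVlt; apply/orP; left; apply/eqP.
  congr `|_|; rewrite /f; set a := coords c (phi t).
  set b := coords c (phi t'); set y := coords c g.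
  by apply/rowP => j; rewrite !mxE; ring.
have fU : {homo f : t / U t >-> U t}.
  move=> t /UE tr; apply/UE.
  have z0 : `|0 : 'rV[R]_n| <= r by rewrite normr0 ltW.
  have := fB _ _ tr z0.
  have f0 : `|f 0| <= r / 2.
    by rewrite /f phi1 sub0r normrN distrC ltW.
  rewrite subr0 => h; have := ler_normD (f t - f 0) (f 0); rewrite subrK; lra.
have [t /UE tr tf] : exists2 t, U t & t = mkfun_fun fU t.
  apply: banach_fixed_point.
  - exists (1 / 2)%:nng; split => /=; first by lra.
    by move=> [t t'] /= [/UE tr /UE tr']; exact: fB.
  - exact: closed_closed_ball_.
  - by exists 0; apply/UE; rewrite normr0 ltW.
have [||ct _ _] := H t t; [lra|lra|].
exists t; first lra.
rewrite -[LHS](coordK ct) -[RHS](coordK cg); congr (param c _).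
have : t = f t by exact: tf.
rewrite /f => /esym/eqP; rewrite subr_eq -[X in X == _]addr0 => /eqP/addrI.
by move/esym/eqP; rewrite subr_eq0 => /eqP.
Qed.

End StrictDifferentiability.

(** * Homogeneous distances *)

Section HomogeneousDistance.
Context (R : realType) (n : nat) (G : topGroupType).
Context (A : set (chart R n G)) (c : chart R n G).
Context (s : nat) (V : nat -> {vspace 'rV[R]_n}).
Context (E : 'rV[R]_n -> G) (delta : R -> G -> G) (d : G -> G -> R).
Hypotheses (G_lie : lie_group A) (Ac : A c) (c1 : dom c (1%g : G)).
Hypotheses (E_exp : exponential c E) (V_strat : stratification c s V).
Hypotheses (delta_dil : dilations s V E delta).
Hypotheses (d_hom : homogeneous_distance delta d).

Local Notation e0 := (coords c (1%g : G)).

Lemma exp0 : E 0 = 1%g.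
Proof. by have [] := strict_exp G_lie Ac c1 0 E_exp; rewrite scale0r. Qed.

Lemma expD v (a b : R) : (E (a *: v) * E (b *: v))%g = E ((a + b) *: v).
Proof. by have [_ ->] := E_exp v. Qed.

Lemma expN v : E (- v) = (E v)^-1%g.
Proof.
have := expD v (-1) 1; rewrite addNr scale0r exp0 scaleN1r scale1r => H.
by rewrite -[LHS]mulg1 -(mulgV (E v)) mulgA H mul1g.
Qed.

Lemma distMl g x y : d (g * x)%g (g * y)%g = d x y.
Proof. exact: homd_left_invariant d_hom _ _ _. Qed.

Lemma dist_tri x y z : d x z <= d x y + d y z.
Proof. exact: metric_tri (homd_metric d_hom) _ _ _. Qed.

Lemma dist_symm x y : d x y = d y x.
Proof. exact: metric_symm (homd_metric d_hom) _ _. Qed.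

Lemma dist_ge0 x y : 0 <= d x y.
Proof. exact: metric_ge0 (homd_metric d_hom) _ _. Qed.

Lemma dist_refl x : d x x = 0.
Proof. exact/(metric_eq0 (homd_metric d_hom)). Qed.

Lemma dist1M g h : d 1%g (g * h)%g <= d 1%g g + d 1%g h.
Proof. by apply: le_trans (dist_tri _ g _) _; rewrite -{2}[g]mulg1 distMl. Qed.

Lemma dist1V g : d 1%g g^-1%g = d 1%g g.
Proof. by rewrite -(distMl g) mulg1 mulgV dist_symm. Qed.

Lemma dist1X g k : d 1%g (g ^+ k)%g <= k%:R * d 1%g g.
Proof.
elim: k => [|k IH]; first by rewrite expg0 dist_refl mul0r.
by rewrite expgS -natr1 mulrDl mul1r addrC (le_trans (dist1M _ _))// lerD2l.
Qed.

Lemma dilation_layer (l : R) (k : nat) X : (k < s)%N -> X \in V k.+1 ->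
  delta l (E X) = E (l ^+ k.+1 *: X).
Proof.
move=> ks XV; pose F (i : 'I_s) := if i == Ordinal ks then X else 0.
have := @delta_dil l F; have -> : \sum_(i < s) F i = X.
  rewrite (bigD1 (Ordinal ks))//= /F eqxx big1 ?addr0// => i /negbTE -> //.
have -> : \sum_(i < s) l ^+ i.+1 *: F i = l ^+ k.+1 *: X.
  rewrite (bigD1 (Ordinal ks))//= /F eqxx big1 ?addr0// => i /negbTE ->.
  by rewrite scaler0.
by apply=> i; rewrite /F; case: eqP => [->//|_]; exact: mem0v.
Qed.

Lemma dist1_dilation (l : R) (k : nat) X : (k < s)%N -> X \in V k.+1 ->
  0 < l -> d 1%g (E (l ^+ k.+1 *: X)) = l * d 1%g (E X).
Proof.
move=> ks XV l0; rewrite -(dilation_layer _ ks XV).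
rewrite -(homd_dilation d_hom)//; congr (d _ _).
by rewrite -exp0 (dilation_layer _ ks (mem0v _)) scaler0.
Qed.

Lemma dist1_exp_abs (t : R) X : d 1%g (E (`|t| *: X)) = d 1%g (E (t *: X)).
Proof.
have [t0|t0] := leP 0 t; first by rewrite ger0_norm.
by rewrite ltr0_norm// scaleNr expN dist1V.
Qed.

Definition dist_vanishes (T : normedModType R) (phi : T -> G) :=
  forall eps : R, 0 < eps -> exists2 del, 0 < del &
    forall t, `|t| < del -> d 1%g (phi t) < eps.

Lemma dist_vanishes_prod (T : normedModType R) (I : Type) (r : seq I)
    (phi : I -> T -> G) :
  (forall i, dist_vanishes (phi i)) ->
  dist_vanishes (fun t => \big[*%g/1%g]_(i <- r) phi i t).
Proof.
move=> H; elim: r => [|i r IH] eps eps0.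
  by exists 1 => // t _; rewrite big_nil dist_refl.
have [d1 d10 H1] := H i _ (divr_gt0 eps0 (ltr0n _ 2)).
have [d2 d20 H2] := IH _ (divr_gt0 eps0 (ltr0n _ 2)).
exists (Num.min d1 d2); first by rewrite lt_min d10.
move=> t; rewrite lt_min => /andP[t1 t2]; rewrite big_cons.
by rewrite (le_lt_trans (dist1M _ _))// [eps]splitr ltrD// ?H1 ?H2.
Qed.

(** On [V k.+1], homogeneity gives [d 1 (E (m ^+ k.+1 *: X)) = m * d 1 (E X)],
    and [|t|] is the power [m ^+ k.+1] of a number [m] that is small with [t]. *)
Lemma dist_vanishes_layer (k : nat) X : (k < s)%N -> X \in V k.+1 ->
  dist_vanishes (fun t : R => E (t *: X)).
Proof.
move=> ks XV eps eps0.
pose D := d 1%g (E X) + 1.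
have D0 : 0 < D by rewrite ltr_wpDl// dist_ge0.
pose l := eps / D.
have l0 : 0 < l by rewrite divr_gt0.
exists (l ^+ k.+1); first exact: exprn_gt0.
move=> t tl; have [->|t0] := eqVneq t 0; first by rewrite scale0r exp0 dist_refl.
pose m := `|t| `^ k.+1%:R^-1.
have m0 : 0 < m by apply: powR_gt0; rewrite normr_gt0.
have mE : m ^+ k.+1 = `|t|.
  by rewrite -powR_mulrn ?(ltW m0)// -powRrM mulVf// powRr1.
have ml : m < l by rewrite -(@ltr_pXn2r _ k.+1) ?nnegrE ?mE ?ltW.
rewrite -dist1_exp_abs -mE (dist1_dilation ks XV m0).
apply: (@lt_le_trans _ _ (m * D)).
  by rewrite ltr_pM2l// ltrDl.
by rewrite -ler_pdivlMr// ltW.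
Qed.

(** Products of one-parameter subgroups tangent to the layers are close to the
    identity for [d] when their parameters are small, and they fill a
    neighbourhood of the identity. *)
Lemma dist_continuous_at_id (eps : R) : 0 < eps -> exists2 rho, 0 < rho &
  forall g, dom c g -> `|coords c g - e0| < rho -> d 1%g g < eps.
Proof.
have dec (i : 'I_n) : exists X : 'I_s -> 'rV[R]_n,
    (forall k, X k \in V k.+1) /\ delta_mx ord0 i = \sum_k X k.
  have : delta_mx ord0 i \in (\sum_(k < s) V k.+1)%VS.
    by rewrite (strat_full V_strat) memvf.
  by move/memv_sumP => [X XV ->]; exists X; split => // k; exact: XV.
(* Component [k] of the basis vector [i] is [X i k]; the factors of [Phi] are
   indexed by these pairs. *)
have [X XP] := choice dec.
pose phi (p : 'I_n * 'I_s) (t : 'rV[R]_n) := E (t ord0 p.1 *: X p.1 p.2).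
pose l (i : 'I_n) (t : 'rV[R]_n) : R := t ord0 i.
have phi_strict p : strict_at_id c (phi p) (fun t => t ord0 p.1 *: X p.1 p.2).
  apply: (@strict_comp _ _ _ _ _ _ (fun a : R => E (a *: X p.1 p.2))
    (fun a => a *: X p.1 p.2) (l p.1)).
  - by rewrite /l mxE.
  - by move=> t t'; rewrite /l !mxE.
  - by move=> t; exact: norm_coord_le.
  - exact: (strict_exp G_lie Ac c1).
have phi_vanish p : dist_vanishes (phi p).
  move=> e e_gt0.
  have [d1 d10 H] := dist_vanishes_layer (ltn_ord p.2) ((XP p.1).1 p.2) e_gt0.
  by exists d1 => // t td; apply: H; apply: le_lt_trans td; exact: norm_coord_le.
pose Phi t := \big[*%g/1%g]_(p <- index_enum ('I_n * 'I_s)%type) phi p t.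
have Phi_strict : strict_at_id c Phi id.
  have := strict_prod G_lie Ac c1 (index_enum ('I_n * 'I_s)%type) phi_strict.
  congr strict_at_id; apply/funext => t.
  rewrite -(pair_bigA _ (fun i k => t ord0 i *: X i k)) /=.
  rewrite [RHS]row_sum_delta; apply: eq_bigr => i _.
  by rewrite (XP i).2 scaler_sumr.
move=> eps0.
have [d1 d10 H1] := dist_vanishes_prod (index_enum ('I_n * 'I_s)%type) phi_vanish eps0.
have [rho rho0 H] := strict_locally_onto Phi_strict d10.
by exists rho => // g cg /(H g cg)[t td <-]; exact: H1.
Qed.

(** Trotter's product formula, measured by the distance. With
    [q = E (tau X) * E (tau Y)] and [r = E (tau (X + Y))], the error
    [z j = r ^- j * q ^+ j] satisfies
      [z j.+1 = (r ^- j * (r ^- 1 * q) * r ^+ j) * z j].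
    In the chart [r ^- 1 * q] is [o(tau)], and the conjugation by [r ^+ j] costs
    a bounded factor because [r ^+ j = E (j tau (X + Y))] stays in a small ball
    for [j <= k]. So [z k] is at distance at most [k * o(T / k)] from the
    identity. *)
Lemma trotter (X Y : 'rV[R]_n) : exists2 T : R, 0 < T &
  forall eps, 0 < eps -> exists2 k : nat, (0 < k)%N &
    d 1%g (E (T *: (X + Y))) <=
    d 1%g ((E ((T / k%:R) *: X) * E ((T / k%:R) *: Y)) ^+ k)%g + eps.
Proof.
pose Z := X + Y.
have [d0 d00 Hm] := group_mul_strict G_lie Ac c1 (@ltr01 R).
have lip g g' h h' : dom c g -> dom c g' -> dom c h -> dom c h' ->
    `|coords c g - e0| < d0 -> `|coords c g' - e0| < d0 ->
    `|coords c h - e0| < d0 -> `|coords c h' - e0| < d0 ->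
    dom c (g * h)%g /\ `|coords c (g * h)%g - coords c (g' * h')%g| <=
      2 * (`|coords c g - coords c g'| + `|coords c h - coords c h'|).
  move=> cg cg' ch ch' gd gd' hd hd'.
  have [cgh _ b] := Hm _ _ _ _ cg cg' ch ch' gd gd' hd hd'.
  split=> //; set m := coords c (g * h)%g - _ in b *.
  set u := coords c g - _ in b *; set v := coords c h - _ in b *.
  have := ler_normD (m - u - v) (u + v); have := ler_normD u v.
  have -> : m - u - v + (u + v) = m by rewrite -[m - u - v]addrA -opprD subrK.
  lra.
(* All the points [E (a *: Z)], [|a| <= T], lie well inside the ball of radius
   [d0] where [lip] applies. *)
have [T T0 HT] : exists2 T : R, 0 < T & forall a, `|a| <= T ->
    dom c (E (a *: Z)) /\ `|coords c (E (a *: Z)) - e0| < d0 / 4.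
  have [E1 [K K0 KL] /(_ 1 ltr01)[d1 d10 H]] := strict_exp G_lie Ac c1 Z E_exp.
  pose T := Num.min d1 (d0 / 4 / (K + 1)) / 2.
  have K1 : 0 < K + 1 by rewrite ltr_wpDl.
  have m0 : 0 < Num.min d1 (d0 / 4 / (K + 1)) by rewrite lt_min d10 !divr_gt0.
  have T0 : 0 < T by rewrite divr_gt0.
  have T2 : T < Num.min d1 (d0 / 4 / (K + 1)) by rewrite /T; lra.
  move: T2; rewrite lt_min => /andP[Td1 TK].
  exists T => // a aT; have ad1 := le_lt_trans aT Td1.
  have z1 : `|0 : R| < d1 by rewrite normr0.
  have [ca _] := H a 0 ad1 z1; rewrite subr0 E1 mul1r => b; split => //.
  have := ler_normD (coords c (E (a *: Z)) - e0 - a *: Z) (a *: Z).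
  rewrite subrK; have := KL a.
  have : `|a| * (K + 1) < d0 / 4.
    by rewrite -ltr_pdivlMr//; exact: le_lt_trans TK.
  lra.
exists T => // eps eps0.
have [rho rho0 Hrho] := dist_continuous_at_id eps0.
pose mu := Num.min rho d0.
have mu0 : 0 < mu by rewrite lt_min rho0.
have mur : mu <= rho by rewrite ge_min lexx.
have mud : mu <= d0 by rewrite ge_min lexx orbT.
(* Each factor of the error contributes at most [8 * eta * tau]: a factor 2 from
   [lip] for each of the three multiplications. The [k] of them add up to
   [8 * eta * T = mu / 2]. *)
pose eta := mu / 16 / T.
have eta0 : 0 < eta by rewrite !divr_gt0.
have etaT : eta * T = mu / 16 by rewrite /eta divfK// gt_eqF.
pose hh (t : R) := (E (t *: - Z) * E (t *: X) * E (t *: Y))%g.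
have [d2 d20 Hh] : exists2 d2, 0 < d2 & forall t, `|t| < d2 ->
    dom c (hh t) /\ `|coords c (hh t) - e0| <= eta * `|t|.
  have [h1 _ /(_ eta eta0)[d2 d20 H]] := strict_mul G_lie Ac c1
    (strict_mul G_lie Ac c1 (strict_exp G_lie Ac c1 (- Z) E_exp)
      (strict_exp G_lie Ac c1 X E_exp)) (strict_exp G_lie Ac c1 Y E_exp).
  exists d2 => // t td; have z2 : `|0 : R| < d2 by rewrite normr0.
  have [ch _] := H t 0 td z2.
  have LE : t *: - Z + t *: X + t *: Y = 0.
    by rewrite -!scalerDr -[- Z + X + Y]addrA addNr scaler0.
  by rewrite h1 !subr0 LE subr0.
pose k := (Num.truncn (T / d2)).+1.
have k0 : (0 : R) < k%:R by rewrite ltr0n.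
have Tk : T / k%:R < d2.
  rewrite ltr_pdivrMr// mulrC -ltr_pdivrMr//; exact: truncnS_gt.
exists k => //.
set tau := T / k%:R.
have tau0 : 0 < tau by rewrite divr_gt0.
have kT : k%:R * tau = T by rewrite mulrC divfK// gt_eqF.
set q := (E (tau *: X) * E (tau *: Y))%g.
have [ch hE] : dom c (hh tau) /\ `|coords c (hh tau) - e0| <= eta * tau.
  by rewrite -{3}(gtr0_norm tau0); apply: Hh; rewrite gtr0_norm.
set nh := `|coords c (hh tau) - e0| in hE.
have nh0 : 0 <= nh by exact: normr_ge0.
have knh : k%:R * nh <= mu / 16.
  by rewrite -etaT -kT mulrCA ler_wpM2l// ltW.
have nhle : nh <= mu / 16.
  by apply: le_trans knh; rewrite ler_peMl// ler1n.
have hnd : nh < d0 / 8 by lra.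
have hd : `|coords c (hh tau) - e0| < d0 by rewrite -/nh; lra.
pose z (j : nat) := (E (- (j%:R * tau) *: Z) * q ^+ j)%g.
have zS j : z j.+1 = ((E (- (j%:R * tau) *: Z) * hh tau * E ((j%:R * tau) *: Z))
    * z j)%g.
  have hq : hh tau = (E (tau *: - Z) * q)%g by rewrite /hh -mulgA.
  have -> : (E (- (j%:R * tau) *: Z) * hh tau * E ((j%:R * tau) *: Z) * z j =
      E (- (j%:R * tau) *: Z) * hh tau * q ^+ j)%g.
    rewrite -[LHS]mulgA; congr (_ * _)%g.
    by rewrite /z mulgA expD addrN scale0r exp0 mul1g.
  rewrite hq /z expgS !mulgA scalerN -scaleNr expD.
  have -> // : - (j.+1%:R * tau) = - (j%:R * tau) - tau.
  by rewrite -natr1; ring.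
have zP (j : nat) : (j <= k)%N -> dom c (z j) /\ `|coords c (z j) - e0| <= 8 * j%:R * nh.
  elim: j => [_|j IH jk].
    by rewrite /z mul0r oppr0 scale0r exp0 mul1g expg0 subrr normr0 mulr0 mul0r.
  have [cz zb] := IH (ltnW jk).
  have jkR : j%:R + 1 <= k%:R :> R by rewrite natr1 ler_nat.
  have zd : `|coords c (z j) - e0| < d0.
    by apply: le_lt_trans zb _; rewrite -mulrA; nra.
  have jT : `|j%:R * tau| <= T.
    rewrite ger0_norm; last by rewrite mulr_ge0// ltW.
    by rewrite -[leRHS]kT ler_wpM2r ?(ltW tau0)// ler_nat ltnW.
  have [cb bb] := HT _ jT.
  have jTN : `|- (j%:R * tau)| <= T by rewrite normrN.
  have [ca ab] := HT _ jTN.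
  set a := E _ in ca ab; set b := E _ in cb bb.
  have abE : (a * b)%g = 1%g by rewrite /a /b expD addNr scale0r exp0.
  have quarter : d0 / 4 < d0 by rewrite gtr_pMr// invf_lt1// ltr1n.
  have ad := lt_trans ab quarter; have bd := lt_trans bb quarter.
  have n1 : `|e0 - e0| < d0 by rewrite subrr normr0.
  have [cah] := lip a a (hh tau) 1%g ca ca ch c1 ad ad hd n1.
  rewrite mulg1 subrr normr0 add0r -/nh => ahb.
  have ahd : `|coords c (a * hh tau)%g - e0| < d0.
    have := ler_normD (coords c (a * hh tau)%g - coords c a) (coords c a - e0).
    rewrite subrKA; clear -ahb ab hnd nh0; lra.
  have [ccj] := lip (a * hh tau)%g a b b cah ca cb cb ahd ad
    bd bd.
  rewrite abE subrr normr0 addr0 => cjb.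
  have cjd : `|coords c (a * hh tau * b)%g - e0| < d0.
    by apply: le_lt_trans cjb _; clear -ahb hnd nh0; lra.
  have [czz] := lip (a * hh tau * b)%g 1%g (z j) (z j) ccj c1 cz cz cjd n1 zd zd.
  rewrite mul1g subrr normr0 addr0 => zzb.
  rewrite zS; split => //.
  have := ler_normD (coords c (a * hh tau * b * z j)%g - coords c (z j))
    (coords c (z j) - e0).
  rewrite subrKA -(natr1 j); clear -zzb cjb ahb zb; lra.
have [czk zkb] := zP k (leqnn k).
have : d 1%g (z k) < eps by apply: Hrho => //; lra.
have -> : d 1%g (z k) = d (q ^+ k)%g (E (T *: Z)).
  rewrite dist_symm /z kT -[RHS](distMl (E (- T *: Z))) expD addNr scale0r.
  by rewrite exp0.
by move=> /ltW H; apply: le_trans (dist_tri _ (q ^+ k)%g _) _; rewrite lerD2l.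
Qed.

(** Rewriting [d 1 (E X * E Y)] as [d (E (- X)) (E Y)] shows that this
    distance is homogeneous in [(X, Y)]: dilations scale the distance between
    two points, and both points are exponentials of vectors of [V 1]. *)
Lemma dist_exp_add_le X Y : X \in V 1%N -> Y \in V 1%N ->
  d 1%g (E (X + Y)) <= d 1%g (E X * E Y)%g.
Proof.
move=> XV YV; have s0 := strat_step V_strat.
have layer1 W (l : R) : W \in V 1%N -> 0 < l ->
    d 1%g (E (l *: W)) = l * d 1%g (E W).
  by move=> WV l0; rewrite -(dist1_dilation s0 WV l0) expr1.
have mulE W W' : d 1%g (E W * E W')%g = d (E (- W)) (E W').
  by rewrite -(distMl (E W) (E (- W))) expN mulgV.
have dilM (l : R) : 0 < l ->
    d 1%g (E (l *: X) * E (l *: Y))%g = l * d 1%g (E X * E Y)%g.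
  move=> l0; rewrite !mulE -scalerN.
  have NX : - X \in V 1%N by rewrite memvN.
  by rewrite -(homd_dilation d_hom)// !(dilation_layer _ s0)// expr1.
have [T T0 H] := trotter X Y.
suff : T * d 1%g (E (X + Y)) <= T * d 1%g (E X * E Y)%g by rewrite ler_pM2l.
apply/ler_addgt0Pr => eps eps0; have [k k0 {}H] := H _ eps0.
rewrite -layer1 ?memvD//; apply: le_trans H _; rewrite lerD2r.
have kR : (0 : R) < k%:R by rewrite ltr0n.
apply: le_trans (dist1X _ _) _.
by rewrite dilM ?divr_gt0// mulrA mulrCA divff ?gt_eqF// mulr1.
Qed.

Definition broken_line X Y (t : R) : G :=
  if t <= 0 then E (t *: X) else E (t *: Y).

(** Across the corner the triangle inequality through the identity is an
    equality, since the projection norm is additive on the cone over a segment of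
    its unit sphere. *)
Lemma broken_line_geodesic X Y : X \in V 1%N -> Y \in V 1%N ->
  (forall t : R, 0 <= t <= 1 ->
    projection_norm E d ((1 - t) *: X + t *: Y) = 1) ->
  infinite_geodesic d (broken_line X Y).
Proof.
move=> XV YV N1; have s0 := strat_step V_strat.
have layer1 W (l : R) : W \in V 1%N -> d 1%g (E (l *: W)) = `|l| * d 1%g (E W).
  move=> WV; rewrite -dist1_exp_abs; have [->|l0] := eqVneq l 0.
    by rewrite normr0 scale0r exp0 dist_refl mul0r.
  have l0' : 0 < `|l| by rewrite normr_gt0.
  by rewrite -(dist1_dilation s0 WV l0') expr1.
have NX : d 1%g (E X) = 1.
  have := N1 0; rewrite subr0 scale1r scale0r addr0 lexx ler01.
  by move=> /(_ isT).
have NY : d 1%g (E Y) = 1.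
  have := N1 1; rewrite subrr scale1r scale0r add0r lexx ler01.
  by move=> /(_ isT).
have line W (a b : R) : W \in V 1%N -> d 1%g (E W) = 1 ->
    d (E (a *: W)) (E (b *: W)) = `|a - b|.
  move=> WV W1; rewrite -(distMl (E (- a *: W))) !expD addNr scale0r exp0.
  by rewrite layer1// W1 mulr1 distrC addrC.
have corner (a b : R) : a <= 0 -> 0 < b ->
    d (E (a *: X)) (E (b *: Y)) = b - a.
  move=> a0 b0; have ba : 0 < b - a by rewrite subr_gt0 (le_lt_trans a0).
  apply/eqP; rewrite eq_le; apply/andP; split.
    apply: le_trans (dist_tri _ 1%g _) _.
    rewrite dist_symm !layer1// NX NY !mulr1 ler0_norm// gtr0_norm//.
    by rewrite addrC.
  rewrite -(distMl (E (- a *: X))) expD addNr scale0r exp0.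
  apply: le_trans (dist_exp_add_le _ _); rewrite ?memvZ//.
  (* The point of the segment that is proportional to [- a *: X + b *: Y]. *)
  pose t := b / (b - a).
  have tE : (b - a) * t = b by rewrite /t mulrC divfK// gt_eqF.
  have t01 : 0 <= t <= 1.
    rewrite divr_ge0 ?(ltW b0) ?(ltW ba)//= ler_pdivrMr// mul1r.
    by rewrite lerDl oppr_ge0.
  have -> : - a *: X + b *: Y = (b - a) *: ((1 - t) *: X + t *: Y).
    rewrite scalerDr !scalerA mulrBr mulr1 tE; congr (_ *: _ + _).
    by rewrite addrAC subrr add0r.
  have ZV : (1 - t) *: X + t *: Y \in V 1%N by rewrite memvD// memvZ.
  have := N1 t t01; rewrite /projection_norm layer1// => ->.
  by rewrite mulr1 gtr0_norm.
move=> a b; rewrite /broken_line.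
case: (leP a 0) => a0; case: (leP b 0) => b0; try exact: line.
  by rewrite corner// distrC gtr0_norm// subr_gt0 (le_lt_trans a0).
by rewrite dist_symm corner// gtr0_norm// subr_gt0 (le_lt_trans b0).
Qed.

Lemma exp_inj_ray X Z : (forall t : R, 0 <= t -> E (t *: X) = E (t *: Z)) ->
  X = Z.
Proof.
move=> H.
have HX t : E (t *: X) = E (t *: Z).
  have [/H//|t0] := leP 0 t.
  by rewrite -[t]opprK !(scaleNr (- t)) !expN H// oppr_ge0 ltW.
have [_ _ [_ DX]] := E_exp X; have [_ _ [_ DZ]] := E_exp Z.
have coordE : (fun t : R => coords c (E (t *: X))) =
    (fun t => coords c (E (t *: Z))) by apply/funext => t; rewrite HX.
by move: DX; rewrite coordE DZ.
Qed.

Lemma broken_line_not_affine X Y : X <> Y -> ~ affine_curve E (broken_line X Y).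
Proof.
move=> XY [g [Z gZ]]; apply: XY.
have g1 : g = 1%g.
  by have := gZ 0; rewrite /broken_line lexx !scale0r exp0 mulg1.
have {}gZ t : broken_line X Y t = E (t *: Z) by rewrite gZ g1 mul1g.
transitivity Z; last apply: esym; apply: exp_inj_ray => t t0.
  have := gZ (- t); rewrite /broken_line oppr_le0 t0 !scaleNr !expN.
  by move/(congr1 (fun x => x^-1%g)); rewrite !invgK.
have [->|t_neq0] := eqVneq t 0; first by rewrite !scale0r.
by rewrite -gZ /broken_line leNgt lt_neqAle eq_sym t_neq0 t0.
Qed.

End HomogeneousDistance.

Theorem proposition5p2 (R : realType) (n : nat) (G : topGroupType)
    (A : set (chart R n G)) (c : chart R n G)
    (s : nat) (V : nat -> {vspace 'rV[R]_n})
    (E : 'rV[R]_n -> G) (delta : R -> G -> G) (d : G -> G -> R)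
    (G_lie : lie_group A)
    (G_connected : connected [set: G])
    (G_simply_connected : simply_connected R G)
    (c_chart : A c) (c_identity : dom c (1%g : G))
    (E_exp : exponential c E)
    (V_strat : stratification c s V)
    (delta_dil : dilations s V E delta)
    (d_hom : homogeneous_distance delta d) :
  ~ strictly_convex (V 1%N) (projection_norm E d) ->
  exists gamma : R -> G, infinite_geodesic d gamma /\ ~ affine_curve E gamma.
Proof.
move=> not_convex.
have [X [Y [XV YV XY N1]]] : exists X Y, [/\ X \in V 1%N, Y \in V 1%N, X <> Y &
    forall t : R, 0 <= t <= 1 ->
      projection_norm E d ((1 - t) *: X + t *: Y) = 1].
  apply: contrapT => H; apply: not_convex => X Y XV YV XY N1.
  by apply: H; exists X, Y.
exists (broken_line E X Y); split.
  exact: (broken_line_geodesic G_lie c_chart c_identity E_exp V_strat delta_dil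
    d_hom).
exact: (broken_line_not_affine G_lie c_chart c_identity E_exp).
Qed.
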